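(* Let $s\ge 2$ be an integer and let $\Sigma\subset CAT(\Lambda_s^{\mathbb Z})$ be an ID semigroup. Then $\langle\Sigma,\sigma\rangle_{+}\subset CAT(\Lambda_s^{\mathbb N})$ is an ID semigroup.
   Context: $\mathbb N$ includes $0$. $\Lambda_s=\{0,1,\dots,s-1\}$ is the symbol set (discrete topology); $\Lambda_s^{\mathbb N}$ and $\Lambda_s^{\mathbb Z}$ are the spaces of one-sided and two-sided sequences, with the product topology. On both, $\sigma$ is the left shift, $\sigma(a)_k=a_{k+1}$. For $\Omega=\Lambda_s^{\mathbb N}$ or $\Lambda_s^{\mathbb Z}$, $CAT(\Omega)$ is the semigroup (under composition) of all continuous maps $\tau:\Omega\to\Omega$ with $\tau\sigma=\sigma\tau$. Embedding of $CAT(\Lambda_s^{\mathbb N})$ in $CAT(\Lambda_s^{\mathbb Z})$: every $\tau\in CAT(\Lambda_s^{\mathbb N})$ is given by a block map $f_\tau:\Lambda_s^{r+1}\to\Lambda_s$ for some $r\in\mathbb N$, via $\tau(a)_k=f_\tau(a_k a_{k+1}\dots a_{k+r})$ for all $k$; the same formula for all $k\in\mathbb Z$ defines an element of $CAT(\Lambda_s^{\mathbb Z})$. Under this correspondence $CAT(\Lambda_s^{\mathbb N})$ is regarded as a subset of $CAT(\Lambda_s^{\mathbb Z})$. $\langle\Sigma,\tau\rangle$ denotes the semigroup generated under composition by $\tau$ and all elements of $\Sigma$. For a semigroup $\Sigma'\subset CAT(\Lambda_s^{\mathbb Z})$ with $\sigma\in\Sigma'$, $\Sigma'_+=\Sigma'\cap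 CAT(\Lambda_s^{\mathbb N})$, regarded as a semigroup acting on $\Lambda_s^{\mathbb N}$. A semigroup $\Sigma\subset CAT(\Omega)$ is ID if every closed $\Sigma$-invariant proper subset of $\Omega$ is finite; a set $A$ is $\Sigma$-invariant if $\tau(A)\subset A$ for all $\tau\in\Sigma$. *)

(* Defs.v *)
From mathcomp Require Import all_boot all_order all_algebra.
From mathcomp Require Import all_classical all_reals all_analysis.

Set Implicit Arguments.
Unset Strict Implicit.
Unset Printing Implicit Defensive.

Import GRing.Theory.
Local Open Scope classical_set_scope.
Local Open Scope ring_scope.

(* The index type K is nat for one-sided sequences and int for two-sided ones;
   a pzSemiRingType provides both with [k + 1] and with the cast [i%:R]. *)
Notation symbols s := (discrete_topology 'I_s).
Notation sequences K s := {ptws K -> symbols s}.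

Definition left_shift {K : pzSemiRingType} {s : nat} (a : sequences K s) :
  sequences K s := fun k => a (k + 1).

Definition CAT {K : pzSemiRingType} {s : nat} :
    set (sequences K s -> sequences K s) :=
  [set tau | continuous tau /\ tau \o left_shift = left_shift \o tau].

Definition comp_closed {T : Type} (S : set (T -> T)) : Prop :=
  forall f g, S f -> S g -> S (f \o g).

Definition generated {T : Type} (S : set (T -> T)) (tau : T -> T) :
  set (T -> T) := smallest comp_closed (S `|` [set tau]).

Definition invariant_set {T : Type} (S : set (T -> T)) (A : set T) : Prop :=
  forall tau, S tau -> tau @` A `<=` A.

(* There is no nonemptiness clause in the notion of semigroup: for s >= 2 the
   empty set of maps is not ID, so it would change nothing here. *)
Definition ID_semigroup {K : pzSemiRingType} {s : nat}
    (S : set (sequences K s -> sequences K s)) : Prop :=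
  [/\ S `<=` CAT, comp_closed S &
      forall A : set (sequences K s),
        closed A -> invariant_set S A -> A `<` setT -> finite_set A].

Definition block_code {K : pzSemiRingType} {s r : nat}
    (f : r.+1.-tuple (symbols s) -> symbols s) (a : sequences K s) :
  sequences K s := fun k => f [tuple a (k + (i : nat)%:R) | i < r.+1].

Definition corresponds {s : nat} (tau : sequences nat s -> sequences nat s)
    (tau' : sequences int s -> sequences int s) : Prop :=
  exists (r : nat) (f : r.+1.-tuple (symbols s) -> symbols s),
    tau = block_code f /\ tau' = block_code f.

Definition one_sided_part {s : nat}
    (S : set (sequences int s -> sequences int s)) :
    set (sequences nat s -> sequences nat s) :=
  [set tau | CAT tau /\ exists2 tau', S tau' & corresponds tau tau'].

(* Main.v *)
(* Given a closed invariant proper set A of one-sided sequences, let B be the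
   set of two-sided sequences all of whose right tails lie in A. B is closed and
   proper, and it is Sigma-invariant: each tau in Sigma is a sliding block code,
   so sigma^n tau looks only to the right for large n and therefore preserves A.
   Hence B is finite, and the points of B are determined, to the right of 0, by a
   word of some fixed length m. By compactness there is n such that every word of
   length m + 1 occurring at a position >= n in a point a of A occurs in B;
   overlapping these words shows that sigma^n a is a right tail of a point of B.
   So a is determined by n symbols and a point of B, and A is finite. *)
Require Import Defs.
From mathcomp Require Import all_boot all_order all_algebra.
From mathcomp Require Import all_classical all_reals all_analysis.
From mathcomp Require Import zify.

Local Open Scope classical_set_scope.
Local Open Scope ring_scope.
Import Order.TTheory GRing.Theory Num.Theory.

(** * Cylinder sets, continuity and compactness *)

Lemma nbhs_sequencesP {K : pzSemiRingType} {s : nat} (a : sequences K s)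
    (U : set (sequences K s)) :
  nbhs a U <-> exists J : seq K, forall b, {in J, b =1 a} -> U b.
Proof.
split=> [|[J JU]]; last first.
  elim: J U JU => [|j J IH] U JU.
    by apply: filterS filterT => b _; apply: JU.
  have aj : nbhs a [set b : sequences K s | b j = a j].
    apply: (@proj_continuous K (fun=> symbols s) j a [set c | c = a j]).
    by rewrite nbhs_principalE; apply/principal_filterP.
  have aJ : nbhs a [set b : sequences K s | {in J, b =1 a}] by apply: IH.
  apply: filterS (filterI aj aJ) => b [bj bJ]; apply: JU => i.
  by rewrite inE => /predU1P[->|/bJ].
pose F : set_system (sequences K s) :=
  [set V | exists J : seq K, forall b, {in J, b =1 a} -> V b].
have FF : Filter F.
  split; first by exists [::].
    move=> V W [J JV] [L LW]; exists (J ++ L) => b bJL; split.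
      by apply: JV => i iJ; apply: bJL; rewrite mem_cat iJ.
    by apply: LW => i iL; apply: bJL; rewrite mem_cat iL orbT.
  by move=> V W VW [J JV]; exists J => b /JV /VW.
(* The product topology is a supremum of initial topologies, so convergence of the cylinder filter
   is checked one coordinate at a time. *)
suff : F --> a by move=> h /h.
apply/cvg_sup => i V [B [[C oC <-] Ci] BV].
by exists [:: i] => b bi; apply: BV; rewrite /= (bi i) // inE.
Qed.

Lemma sequences_continuousP {K L : pzSemiRingType} {s : nat}
    (F : sequences K s -> sequences L s) :
  continuous F <-> forall a l, exists J : seq K,
    forall b, {in J, b =1 a} -> F b l = F a l.
Proof.
split=> [cF a l|hF a U].
  apply/(nbhs_sequencesP a [set b | F b l = F a l]).
  apply: (cF a [set c | c l = F a l]); apply/nbhs_sequencesP.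
  by exists [:: l] => b; apply; rewrite inE.
move=> /nbhs_sequencesP[J JU]; apply/nbhs_sequencesP.
elim: J U JU => [|j J IH] U JU; first by exists [::] => b _; apply: JU.
have [J1 J1P] := hF a j.
have [J2 J2P] := IH [set b : sequences L s | {in J, b =1 F a}] (fun b h => h).
exists (J1 ++ J2) => b bJ; apply: JU => i; rewrite inE => /predU1P[->|iJ].
  by apply: J1P => k kJ; apply: bJ; rewrite mem_cat kJ.
by apply: J2P => // k kJ; apply: bJ; rewrite mem_cat kJ orbT.
Qed.

Lemma sequences_compact (K : pzSemiRingType) (s : nat) :
  compact [set: sequences K s].
Proof.
have csym : compact [set: symbols s].
  by apply: finite_compact; exact: (@finite_finset 'I_s setT).
have := @tychonoff K (fun=> symbols s) (fun=> setT) (fun=> csym).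
by congr compact; apply/seteqP; split.
Qed.

Lemma continuous_left_shift {K : pzSemiRingType} {s : nat} :
  continuous (@left_shift K s).
Proof.
apply/sequences_continuousP => a l; exists [:: l + 1] => b ba.
by rewrite /left_shift ba// inE.
Qed.

(** * Block codes and shift-commuting maps *)

Lemma CAT_comp {K : pzSemiRingType} {s : nat}
    (f g : sequences K s -> sequences K s) : CAT f -> CAT g -> CAT (f \o g).
Proof.
move=> [cf sf] [cg sg]; split; first by move=> a; exact: continuous_comp (cg a) (cf (g a)).
by rewrite -compA sg compA sf.
Qed.

Lemma CAT_block_code {K : pzSemiRingType} {s r : nat}
    (f : r.+1.-tuple (symbols s) -> symbols s) : CAT (@block_code K s r f).
Proof.
split.
  apply/sequences_continuousP => a l.
  exists [seq l + (nat_of_ord i)%:R | i <- enum 'I_r.+1] => b ba; congr f.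
  apply: eq_from_tnth => i; rewrite !tnth_mktuple ba//.
  by apply/mapP; exists i => //; rewrite mem_enum.
apply/funext => a; apply/funext => k; congr f.
by apply: eq_from_tnth => i; rewrite !tnth_mktuple /left_shift addrAC.
Qed.

(** The rule [h] is chosen before [K]: [corresponds] asks for one rule that serves both index
    types. *)
Lemma block_code_comp {s q r : nat}
    (g : q.+1.-tuple (symbols s) -> symbols s)
    (f : r.+1.-tuple (symbols s) -> symbols s) :
  exists h : (q + r).+1.-tuple (symbols s) -> symbols s,
    forall K : pzSemiRingType,
      @block_code K s q g \o block_code f = block_code h.
Proof.
exists (fun w => g [tuple f [tuple tnth w (inord (j + i)) | i < r.+1] | j < q.+1]).
move=> K; apply/funext => a; apply/funext => k; congr g.
apply: eq_from_tnth => j; rewrite !tnth_mktuple; congr f.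
apply: eq_from_tnth => i; rewrite !tnth_mktuple inordK ?natrD ?addrA//.
by rewrite ltnS leq_add// -ltnS.
Qed.

Lemma iter_left_shiftE {K : pzSemiRingType} {s : nat} n (a : sequences K s) k :
  iter n left_shift a k = a (k + n%:R).
Proof.
elim: n k => [|n IH] k; first by rewrite addr0.
by rewrite iterS /left_shift IH -addrA -natr1 [1 + _]addrC.
Qed.

Lemma CAT_int_translate {s : nat} (tau : sequences int s -> sequences int s)
    (k j : int) (b : sequences int s) :
  CAT tau -> tau (fun i => b (i + k)) j = tau b (j + k).
Proof.
case=> _ tauS; have tauSn n c : tau (iter n left_shift c) = iter n left_shift (tau c).
  by elim: n c => //= n IH c; rewrite -IH; apply: (congr1 (@^~ _) tauS).
case: k => n.
  rewrite -natz -iter_left_shiftE -tauSn; congr tau.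
  by apply/funext => i; rewrite iter_left_shiftE.
set c := (X in tau X).
(* A translation to the left is undone by forward shifts, with which [tau] commutes. *)
have -> : b = iter n.+1 left_shift c.
  by apply/funext => i; rewrite iter_left_shiftE /c NegzE natz addrK.
by rewrite tauSn iter_left_shiftE NegzE natz addrNK.
Qed.

(** Continuity gives a window around 0 that works near each point; compactness makes its radius
    uniform. *)
Lemma sequences_int_unif_cont {s : nat}
    (tau : sequences int s -> sequences int s) : continuous tau ->
  exists n : nat, forall a b : sequences int s,
    (forall j : int, `|j| <= n%:Z -> b j = a j) -> tau b 0 = tau a 0.
Proof.
move=> /sequences_continuousP ctau.
have /compact_near_coveringP cov := @sequences_compact int s.
have := cov nat \oo (fun n a => forall b : sequences int s,
    (forall j : int, `|j| <= n%:Z -> b j = a j) -> tau b 0 = tau a 0) _ _.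
case=> [x _|n _ nP].
  have [J JP] := ctau x 0.
  exists ([set x' : sequences int s | {in J, x' =1 x}],
          [set n | \max_(j <- J) `|j|%N <= n]%N).
    split; first by apply/nbhs_sequencesP; exists J.
    by exists (\max_(j <- J) `|j|%N)%N.
  move=> [x' n] [/= x'x Jn] b bx'; rewrite (JP x')//; apply: JP => j jJ.
  rewrite bx' ?x'x//.
  have : (`|j| <= \max_(j <- J) `|j|)%N by apply: leq_bigmax_seq.
  by move=> /leq_trans/(_ Jn); lia.
by exists n => a; apply: nP => //=.
Qed.

(** A form of the Curtis-Hedlund-Lyndon theorem: the shift by [n] moves the window from [-n, n] to
    [0, 2n]. *)
Lemma CAT_int_block_code {s : nat} (tau : sequences int s -> sequences int s) :
  CAT tau -> exists n (f : (n + n).+1.-tuple (symbols s) -> symbols s),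
    iter n left_shift \o tau = block_code f.
Proof.
move=> Ctau; have [n nP] := sequences_int_unif_cont tau Ctau.1.
(* The word is written on [-n, n]; the values given outside by [absz] and [inord] do not affect
   coordinate 0 of the image. *)
exists n, (fun w => tau (fun j : int => tnth w (inord (absz (j + n%:Z)))) 0).
apply/funext => b; apply/funext => k /=.
rewrite iter_left_shiftE -[k + _]add0r -CAT_int_translate//.
apply: nP => j jn; rewrite tnth_mktuple inordK; last by lia.
by rewrite !natz; congr b; lia.
Qed.

(** * Generated semigroups and their one-sided parts *)

Section generated.
Context {T : Type} (S : set (T -> T)) (tau : T -> T).

Lemma sub_generated : S `<=` generated S tau.
Proof. by move=> f Sf M [_ SM]; apply: SM; left. Qed.

Lemma mem_generated : generated S tau tau.
Proof. by move=> M [_ SM]; apply: SM; right. Qed.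

Lemma comp_closed_generated : comp_closed (generated S tau).
Proof. by move=> f g Sf Sg M Mc; apply: Mc.1; [apply: Sf|apply: Sg]. Qed.

(** The generated semigroup may lack the identity, so the induction starts from [f] itself. *)
Lemma generated_iter n f : S f -> generated S tau (iter n tau \o f).
Proof.
move=> Sf; elim: n => [|n IH]; first exact: sub_generated.
exact: comp_closed_generated mem_generated IH.
Qed.

End generated.

Lemma comp_closed_one_sided_part {s : nat}
    (S : set (sequences int s -> sequences int s)) :
  comp_closed S -> comp_closed (one_sided_part S).
Proof.
move=> Sc f g [Cf [f' Sf' [q [phi [fE f'E]]]]] [Cg [g' Sg' [r [psi [gE g'E]]]]].
split; first exact: CAT_comp.
have [h hE] := block_code_comp phi psi.
exists (f' \o g'); first exact: Sc.
by exists (q + r)%N, h; rewrite fE f'E gE g'E !hE.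
Qed.

(** * The two-sided hull of a one-sided set *)

Definition tail {s : nat} (k : int) (b : sequences int s) : sequences nat s :=
  fun i => b (k + i%:Z).

Lemma continuous_tail {s : nat} k : continuous (@tail s k).
Proof.
apply/sequences_continuousP => a l; exists [:: k + l%:Z] => b ba.
by rewrite /tail ba// inE.
Qed.

Lemma tail_block_code {s r : nat} (f : r.+1.-tuple (symbols s) -> symbols s) k b :
  tail k (block_code f b) = block_code f (tail k b).
Proof.
apply/funext => i; congr f; apply: eq_from_tnth => j.
by rewrite !tnth_mktuple /tail !natz natn PoszD addrA.
Qed.

Definition two_sided_hull {s : nat} (A : set (sequences nat s)) :
  set (sequences int s) := [set b | forall k, A (tail k b)].

Lemma closed_two_sided_hull {s : nat} (A : set (sequences nat s)) :
  closed A -> closed (two_sided_hull A).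
Proof.
move=> cA; have -> : two_sided_hull A = \bigcap_(k in setT) (tail k @^-1` A).
  by apply/seteqP; split=> b Ab k; [move=> _; apply: Ab|apply: (Ab k)].
apply: closed_bigI => k _; apply: preimage_closed => // b _.
exact: continuous_tail.
Qed.

Lemma two_sided_hullT {s : nat} (A : set (sequences nat s)) :
  two_sided_hull A = setT -> A = setT.
Proof.
move=> hT; apply/seteqP; split=> // a _.
(* Any extension of [a] to the left would do; reflection gives one. *)
have : two_sided_hull A (fun k : int => a `|k|%N) by rewrite hT.
by move=> /(_ 0); congr A; apply/funext => i; rewrite /tail add0r.
Qed.

Lemma two_sided_hull_shift {s : nat} (A : set (sequences nat s)) b :
  two_sided_hull A b -> two_sided_hull A (left_shift b).
Proof.
move=> Ab k; have := Ab (k + 1); congr A; apply/funext => i.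
by rewrite /tail /left_shift addrAC.
Qed.

Lemma invariant_two_sided_hull {s : nat}
    (Sigma : set (sequences int s -> sequences int s)) (A : set (sequences nat s)) :
  Sigma `<=` CAT ->
  invariant_set (one_sided_part (generated Sigma left_shift)) A ->
  invariant_set Sigma (two_sided_hull A).
Proof.
move=> SC iA tau Stau _ [b Ab <-] k.
have [n [f fE]] := CAT_int_block_code tau (SC _ Stau).
have -> : tail k (tau b) = block_code f (tail (k - n%:Z) b).
  rewrite -tail_block_code -fE; apply/funext => i.
  by rewrite /tail /= iter_left_shiftE natz; congr (tau b); lia.
apply: (iA (block_code f)); last by exists (tail (k - n%:Z) b).
split; first exact: CAT_block_code.
exists (block_code f); last by exists (n + n)%N, f.
by rewrite -fE; apply: generated_iter.
Qed.

Lemma one_sided_part_left_shift {s : nat}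
    (S : set (sequences int s -> sequences int s)) :
  S left_shift -> one_sided_part S left_shift.
Proof.
move=> SS; have shE (K : pzSemiRingType) :
    @left_shift K s = @block_code K s 1 (fun w => tnth w (inord 1)).
  apply/funext => a; apply/funext => k.
  by rewrite /block_code tnth_mktuple inordK.
split; first by rewrite shE; apply: CAT_block_code.
exists left_shift => //; exists 1%N, (fun w => tnth w (inord 1)).
by rewrite !shE.
Qed.

(* The covering argument is applied to: if [y] continues to the left, from
   position [- n], a point of [A], then [y] agrees with the hull on [0, m). A [y]
   outside the hull has a tail outside the closed set [A], so near it and for
   large [n] this holds vacuously. *)
Lemma tail_word_two_sided_hull {s : nat} (A : set (sequences nat s)) (m : nat) :
  closed A -> (forall a, A a -> A (left_shift a)) ->
  exists N : nat, forall n a, (N <= n)%N -> A a ->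
    exists2 b, two_sided_hull A b & forall i, (i < m)%N -> a (n + i)%N = b i%:Z.
Proof.
move=> cA sA.
have sAn n a : A a -> A (iter n left_shift a).
  by move=> Aa; elim: n => //= n IH; apply: sA.
have /compact_near_coveringP cov := @sequences_compact int s.
have := cov nat \oo (fun n y => forall a, A a ->
    (forall k : int, - n%:Z <= k -> y k = a (absz (k + n%:Z))) ->
    exists2 b, two_sided_hull A b & forall i, (i < m)%N -> y i%:Z = b i%:Z) _ _.
case=> [y _|N _ NP].
  have [Ay|/existsNP[k Ay]] := pselect (two_sided_hull A y).
    exists ([set y' : sequences int s | {in [seq i%:Z | i <- iota 0 m], y' =1 y}], setT).
      split; last exact: filterT.
      by apply/nbhs_sequencesP; exists [seq i%:Z | i <- iota 0 m].
    move=> [y' n] [/= y'y _] a Aa _; exists y => // i im.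
    by apply: y'y; rewrite map_f// mem_iota.
  (* For such [n], position [k] is at or to the right of [- n], so the tail at [k] is a shift of [a]
     and lies in [A]. *)
  exists (tail k @^-1` (~` A), [set n | `|k| <= n]%N).
    split; last by exists `|k|%N.
    apply: continuous_tail; apply: open_nbhs_nbhs; split => //.
    exact: closed_openC.
  move=> [y' n] [/= Ay' kn] a Aa y'a; case: Ay'.
  have -> : tail k y' = iter (absz (k + n%:Z)) left_shift a; last exact: sAn.
  apply/funext => i; rewrite iter_left_shiftE natn /tail y'a; last by lia.
  by congr a; rewrite -[(i + _)%R]/(i + _)%N; lia.
exists N => n a Nn Aa; have [//|//|b Ab bE] := NP n Nn (fun k => a (absz (k + n%:Z))) _ a Aa.
by exists b => // i im; rewrite -bE// -PoszD addnC.
Qed.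

Lemma finite_separating_length {s : nat} (B : set (sequences int s)) :
  finite_set B -> exists m : nat, forall b c, B b -> B c ->
    (forall i, (i < m)%N -> b i%:Z = c i%:Z) -> forall i : nat, b i%:Z = c i%:Z.
Proof.
(* Some position where the pair differs, or the default 0 if there is none; [m] exceeds all these
   positions. *)
move=> fB; pose sep (p : sequences int s * sequences int s) :=
  xget 0%N [set i : nat | p.1 i%:Z <> p.2 i%:Z].
have : finite_set (sep @` (B `*` B)) by apply/finite_image/finite_setX.
move=> /finite_seqP[l lE]; exists (\max_(i <- l) i).+1 => b c Bb Bc bc i.
apply: contrapT => bci.
have := @xgetI _ 0%N [set i : nat | b i%:Z <> c i%:Z] i bci; apply; apply: bc.
have : sep (b, c) \in l.
  have : [set` l] (sep (b, c)) by rewrite -lE; exists (b, c).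
  by [].
move=> h; rewrite ltnS; exact: (@leq_bigmax_seq _ l xpredT id _ h isT).
Qed.

Lemma finite_two_sided_hull {s : nat} (A : set (sequences nat s)) :
  closed A -> (forall a, A a -> A (left_shift a)) ->
  finite_set (two_sided_hull A) -> finite_set A.
Proof.
move=> cA sA fB; have [m mP] := finite_separating_length _ fB.
have [n nP] := tail_word_two_sided_hull A m.+1 cA sA.
(* Rebuilds a point of [A] from its first [n] symbols and a hull point, so [A] lies in the image of
   a finite set. *)
pose glue (p : n.-tuple (symbols s) * sequences int s) : sequences nat s :=
  fun k => if insub k is Some i then tnth p.1 i else p.2 (k - n)%N%:Z.
apply: (@sub_finite_set _ _ (glue @` (setT `*` two_sided_hull A))); last first.
  by apply/finite_image/finite_setX => //; exact: (@finite_finset (n.-tuple 'I_s) setT).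
move=> a Aa; have [b Bb ab] := nP n a (leqnn _) Aa.
have {}ab j i : (i < m.+1)%N -> a (n + j + i)%N = b (j + i)%N%:Z.
  elim: j i => [|j IH] i im; first by rewrite addn0 ab.
  (* The windows of length [m.+1] at [n + j] and [n + j.+1] share [m] symbols, so [c] and the
     shifted [b] agree to the right of 0, and the new symbol of [a] is that of [b]. *)
  have [c Bc ac] := nP (n + j.+1)%N a (leq_addr _ _) Aa.
  have Bbj : two_sided_hull A (iter j.+1 left_shift b).
    by elim: j.+1 => //= k IHk; apply: two_sided_hull_shift.
  rewrite ac// -(mP _ _ Bbj Bc) => [|k km].
    by rewrite iter_left_shiftE natz -PoszD addnC.
  rewrite iter_left_shiftE natz -PoszD -ac 1?ltnW//.
  have -> : (n + j.+1 + k = n + j + k.+1)%N by lia.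
  by rewrite IH// addnC addSnnS.
exists ([tuple a i | i < n], b) => //; apply/funext => k; rewrite /glue.
case: insubP => [i _ <-|]; first by rewrite tnth_mktuple.
rewrite -leqNgt => nk; have := ab (k - n)%N 0%N isT.
by rewrite !addn0 subnKC.
Qed.

Theorem theorem4p3 (s : nat) (hs : (2 <= s)%N)
    (Sigma : set (sequences int s -> sequences int s)) :
  ID_semigroup Sigma -> ID_semigroup (one_sided_part (generated Sigma left_shift)).
Proof.
move=> [SC Sc SID]; split; first by move=> tau [].
  by apply: comp_closed_one_sided_part; exact: comp_closed_generated.
move=> A cA iA [_ AT]; apply: finite_two_sided_hull => //.
  move=> a Aa; apply: (iA left_shift); last by exists a.
  by apply: one_sided_part_left_shift; exact: mem_generated.
apply: SID; [exact: closed_two_sided_hull|exact: invariant_two_sided_hull|].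
rewrite properEneq; split=> //; apply/eqP => /two_sided_hullT AE.
by apply: AT; rewrite AE.
Qed.
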